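(* Let $f, g \in \mathcal{F}_{\text{ND}}$ be non-empty, with $\operatorname{dom}(f) = [a_f, u_f]$ and $\operatorname{dom}(g) = [a_g, u_g]$, and suppose that $a_f \leq g(a_g)$ (hypothesis (H) for the composition $f \circ g$). Then $f \circ g$ is empty if and only if $g(a_g) > u_f$. Otherwise, $\operatorname{dom}(f \circ g) = [a_g, u_{f \circ g}]$ with $u_{f \circ g} = \max\{t \in \operatorname{dom}(g) : g(t) \leq u_f\}$, $f \circ g \in \mathcal{F}_{\text{ND}}$, and $a_{f \circ g} = a_g$, so that, for a further non-empty $g' \in \mathcal{F}_{\text{ND}}$, hypothesis (H) for $(f \circ g) \circ g'$ is the same condition as hypothesis (H) for $g \circ g'$ (namely $a_g \leq g'(a_{g'})$).
   Context: A function $h : [a_h, u_h] \to \mathbb{R}$, with $a_h, u_h \in \mathbb{R}$ and $a_h \leq u_h$, belongs to the class $\mathcal{F}$ of left-continuous piecewise linear functions if it is left-continuous at every $t \in (a_h, u_h]$ and affine on each of finitely many open pieces cutting $[a_h, u_h]$. $\mathcal{F}_{\text{ND}} \subset \mathcal{F}$ denotes the non-decreasing members. We write $\operatorname{dom}(h) = [a_h, u_h]$. The empty partial function $\bot$ is adjoined to these classes as an absorbing element of composition; ''non-empty'' means different from $\bot$. For $f, g \in \mathcal{F}_{\text{ND}}$, $f \circ g$ is the pointwise composition of partial functions: $\operatorname{dom}(f \circ g) = \{t \in \operatorname{dom}(g) : g(t) \in \operatorname{dom}(f)\}$ and $(f \circ g)(t) = f(g(t))$. It is empty ($=\bot$)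 when this domain is empty. Hypothesis (H) for the composition $f \circ g$ of non-empty $f,g$ is the inequality $a_f \leq g(a_g)$. *)

(* Defs.v *)
From mathcomp Require Import all_boot all_order all_algebra.
From mathcomp Require Import all_classical all_reals all_analysis.
Import Order.TTheory GRing.Theory Num.Theory numFieldNormedType.Exports.
Set Implicit Arguments.
Unset Strict Implicit.
Unset Printing Implicit Defensive.
Local Open Scope classical_set_scope.
Local Open Scope ring_scope.

(* A partial function of the real line is a map [R -> option R], undefined where
   it returns [None].  Composition of partial functions is [ssrfun.pcomp]. *)

Definition bot {R : realType} : R -> option R := fun=> None.

Definition dom {R : realType} (h : R -> option R) : set R := [set t | h t].

(* The value [h(t)]; it is only meaningful for [t] in [dom h]. *)
Definition pval {R : realType} (h : R -> option R) (t : R) : R := odflt 0 (h t).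

(* The endpoints [a_h] and [u_h] of a function [h] whose domain is a nonempty
   compact interval [[a_h, u_h]] (see [dom_pwl] below). *)
Definition lend {R : realType} (h : R -> option R) : R := inf (dom h).
Definition rend {R : realType} (h : R -> option R) : R := sup (dom h).

Definition left_continuous_at {R : realType} (h : R -> option R) (t : R) : Prop :=
  pval h s @[s --> t^'-] --> pval h t.

Definition affine_on {R : realType} (A : set R) (h : R -> option R) : Prop :=
  exists m c : R, forall t, A t -> pval h t = m * t + c.

(* The cut points are [a = x_0 < x_1 < ... < x_n = u] with [s = x_1, ..., x_n];
   [s] is empty when [a = u].  Affinity is required on the open pieces only. *)
Definition piecewise_affine {R : realType} (a u : R) (h : R -> option R) : Prop :=
  exists2 s : seq R, itv_partition a u s &
    forall i, (i < size s)%N -> affine_on `](a :: s)`_i, s`_i[%classic h.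

(* The classes F and F_ND, without the empty partial function. *)
Definition pwl {R : realType} : set (R -> option R) :=
  [set h | exists a u : R,
    [/\ a <= u,
        dom h = `[a, u]%classic,
        forall t, t \in `]a, u]%R -> left_continuous_at h t
      & piecewise_affine a u h]].

Definition pwl_nd {R : realType} : set (R -> option R) :=
  [set h | pwl h /\ {in dom h &, {homo pval h : s t / s <= t}}].

(* F_ND with the empty partial function adjoined. *)
Definition pwl_nd_bot {R : realType} : set (R -> option R) := bot |` pwl_nd.

(* Hypothesis (H) for the composition of the non-empty [f] and [g]. *)
Definition hypH {R : realType} (f g : R -> option R) : Prop :=
  lend f <= pval g (lend g).

Definition is_max {R : realType} (A : set R) (m : R) : Prop := A m /\ ubound A m.

Lemma dom_pwl (R : realType) (h : R -> option R) :
  pwl h -> lend h <= rend h /\ dom h = `[lend h, rend h]%classic.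
Proof.
move=> [a [u [au domh _ _]]].
by rewrite /lend /rend domh inf_itv ?sup_itv ?bnd_simp.
Qed.

Lemma pwl_neq_bot (R : realType) (h : R -> option R) : pwl h -> h <> bot.
Proof.
move=> [a [u [au domh _ _]]] hbot.
have : dom h a by rewrite domh /= in_itv /= lexx.
by rewrite hbot.
Qed.

Lemma neq_bot_dom (R : realType) (h : R -> option R) : h = bot <-> dom h = set0.
Proof.
split=> [->|h0]; first by apply/seteqP; split.
apply/funext => t; case E : (h t) => [y|//].
have : dom h t by rewrite /dom /= E.
by rewrite h0.
Qed.

Lemma dom_pcomp (R : realType) (f g : R -> option R) :
  dom (pcomp f g) = [set t | dom g t /\ dom f (pval g t)].
Proof.
by apply/seteqP; split=> t; rewrite /dom /pcomp /pval /=; case: (g t) => [y|] //= [].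
Qed.

Lemma pval_pcomp (R : realType) (f g : R -> option R) (t : R) :
  dom (pcomp f g) t -> pval (pcomp f g) t = pval f (pval g t).
Proof. by rewrite /dom /pcomp /pval /=; case: (g t). Qed.

Lemma pcomp_botl (R : realType) (g : R -> option R) : pcomp bot g = bot.
Proof. by apply/funext => t; rewrite /pcomp; case: (g t). Qed.

Lemma pcomp_botr (R : realType) (f : R -> option R) : pcomp f bot = bot.
Proof. by []. Qed.

(* Main.v *)
Require Import Defs.
From mathcomp Require Import all_boot all_order all_algebra.
From mathcomp Require Import all_classical all_reals all_analysis.
From mathcomp Require Import lra.
Import Order.TTheory GRing.Theory Num.Theory numFieldNormedType.Exports.
Set Implicit Arguments.
Unset Strict Implicit.
Unset Printing Implicit Defensive.
Local Open Scope classical_set_scope.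
Local Open Scope ring_scope.

(** By left continuity and monotonicity, [t |-> g t <= u_f] cuts out an initial
    segment [[a_g, v]] of [dom g], which by (H) is the domain of [f o g].  For
    piecewise affinity, cut [[a_g, v]] at the cut points of [g] and at the
    suprema of the sublevel sets [g <= q], [q] ranging over the cut points of
    [f]: on an open interval avoiding all of these, [g] is affine and is either
    constant or sweeps an open interval avoiding the cut points of [f].  For left
    continuity at [t], either [g] is constant just before [t], or [g s] tends to
    [g t] strictly from below as [s] increases to [t]. *)

Lemma affine_on_sub (R : realType) (A B : set R) (h : R -> option R) :
  A `<=` B -> affine_on B h -> affine_on A h.
Proof. by move=> AB [m [c hB]]; exists m, c => t /AB; exact: hB. Qed.

Lemma pwl_ends (R : realType) (h : R -> option R) : pwl h ->
  [/\ lend h <= rend h,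
      forall t, dom h t <-> lend h <= t <= rend h,
      forall t, lend h < t <= rend h -> left_continuous_at h t
    & piecewise_affine (lend h) (rend h) h].
Proof.
move=> [a [u [au domh lc pa]]].
by rewrite /lend /rend domh inf_itv ?sup_itv ?bnd_simp.
Qed.

(** The points of [P] may come in any order, repeat or lie outside the interval, so sets of cut
    points can be merged by mere concatenation, without sorting. *)
Definition affine_off {R : realType} (P : seq R) (a u : R) (h : R -> option R) :=
  forall x y, a <= x -> x < y -> y <= u ->
    {in P, forall p, p <= x \/ y <= p} -> affine_on `]x, y[%classic h.

Lemma piecewise_affine_cat (R : realType) (a b u : R) (h : R -> option R) :
  piecewise_affine a b h -> piecewise_affine b u h -> piecewise_affine a u h.
Proof.
move=> [s1 s1P h1] [s2 s2P h2]; exists (s1 ++ s2).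
  exact: itv_partition_cat s1P s2P.
have /eqP lasts1 := s1P.2.
move=> i; rewrite size_cat => ilt.
(* This lists the left ends of the pieces so that the list breaks at index [size s1], exactly where
   the list [s1 ++ s2] of right ends does: [b] opens the first piece of [s2]. *)
have -> : a :: s1 ++ s2 = belast a s1 ++ b :: s2.
  by rewrite -cat_cons lastI cat_rcons lasts1.
rewrite !nth_cat size_belast; case: ltnP => i1; last first.
  by apply: h2; rewrite ltn_subLR.
suff -> : (belast a s1)`_i = (a :: s1)`_i by exact: h1.
by rewrite lastI nth_rcons size_belast i1.
Qed.

(** Induction on [P]: a point inside [[a, u]] splits the interval in two, and a point outside
    excludes no subinterval. *)
Lemma affine_off_piecewise (R : realType) (P : seq R) (a u : R)
    (h : R -> option R) :
  a <= u -> affine_off P a u h -> piecewise_affine a u h.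
Proof.
elim: P a u => [|p P IH] a u au hP.
  move: au hP; rewrite le_eqVlt => /predU1P[<- _|au hP].
    by exists [::] => //; split.
  exists [:: u]; first exact: itv_partition1.
  by case=> // _ /=; apply: hP.
have [/andP[ap pu]|apu] := boolP (a <= p <= u).
  apply: (@piecewise_affine_cat _ _ p); apply: IH => // x y ax xy yu Pxy;
    apply: hP => //.
  - exact: le_trans yu pu.
  - by move=> q /predU1P[->|/Pxy]; [right|].
  - exact: le_trans ap ax.
  - by move=> q /predU1P[->|/Pxy]; [left|].
apply: IH => // x y ax xy yu Pxy; apply: hP => // q /predU1P[->|/Pxy//].
move: apu; rewrite negb_and -!ltNge => /orP[pa|up]; [left|right]; lra.
Qed.

(** An open interval avoiding all cut points sits inside a single piece; the induction discards the
    first piece when the interval lies to its right. *)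
Lemma piecewise_affine_off (R : realType) (a u : R) (h : R -> option R) :
  piecewise_affine a u h -> exists P, affine_off P a u h.
Proof.
move=> [s [sP /eqP su] hs]; exists s.
elim: s a sP su hs => [|b s IH] a /=.
  by move=> _ <- _ x y ax xy ya; lra.
move=> /andP[ab sP] su hs x y ax xy yu Pxy.
have [bx|yb] := Pxy b (mem_head _ _).
  apply: (IH b) => // [i is_|q qs]; first exact: (hs i.+1).
  by apply: Pxy; rewrite inE qs orbT.
apply: affine_on_sub (hs 0%N isT) => t /=; rewrite !in_itv /= => /andP[xt ty].
by apply/andP; split; lra.
Qed.

(** Meant for [m * t + c] equal to [g t] on an open piece: [m * x + c] is then the right limit of
    [g] at [x], which may exceed [g x], so bounds have to come from inside the piece. *)
Lemma affine_open_ge (R : realType) (m c q x y : R) :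
  0 < m -> x < y -> (forall t, x < t < y -> q <= m * t + c) -> q <= m * x + c.
Proof.
move=> m0 xy qle; rewrite leNgt; apply/negP => ltq.
have xw : x < (q - c) / m by rewrite ltr_pdivlMr // mulrC; lra.
(* The affine function stays below [q] up to [(q - c) / m]; the cap [y] keeps the midpoint of [x]
   and [z] inside the interval. *)
pose z := Num.min y ((q - c) / m).
have [xz [zy zw]] : x < z /\ z <= y /\ z <= (q - c) / m.
  by rewrite /z lt_min xy xw !ge_min !lexx orbT.
have tw : (x + z) / 2 < (q - c) / m by lra.
have := qle ((x + z) / 2); rewrite ltr_pdivlMr // mulrC in tw.
by move=> /(_ _)/wrap[]; [apply/andP; split; lra | lra].
Qed.

Lemma affine_open_le (R : realType) (m c q x y : R) :
  0 < m -> x < y -> (forall t, x < t < y -> m * t + c <= q) -> m * y + c <= q.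
Proof.
move=> m0 xy leq.
(* The reflection [t -> - t] reduces this to the lower bound. *)
have : - q <= m * (- y) + - c.
  apply: (@affine_open_ge _ _ _ _ _ (- x)) => //; first by lra.
  move=> t /andP[yt tx]; have := leq (- t); rewrite mulrN => /(_ _)/wrap[].
    by apply/andP; split; lra.
  by lra.
by rewrite mulrN; lra.
Qed.

Lemma pwl_nd_le (R : realType) (h : R -> option R) : pwl_nd h ->
  forall s t, lend h <= s -> s <= t -> t <= rend h -> pval h s <= pval h t.
Proof.
move=> [/pwl_ends[_ domh _ _] ndh] s t as_ st tu.
by apply: ndh => //; rewrite inE; apply/domh; apply/andP; split=> //; lra.
Qed.

(** The supremum is attained: any earlier [t] is passed by a point of the sublevel set, so
    [g t <= q] by monotonicity, and left continuity carries the bound to the limit. *)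
Lemma sublevel_has_max (R : realType) (g : R -> option R) (q : R) :
  pwl_nd g -> pval g (lend g) <= q ->
  exists v, is_max [set t | dom g t /\ pval g t <= q] v.
Proof.
move=> ndg gq; have [au domg lc _] := pwl_ends ndg.1.
set S := [set t | _]; exists (sup S).
have S0 : S (lend g) by split=> //; apply/domg; rewrite lexx au.
have Sub : ubound S (rend g) by move=> t [/domg/andP[]].
have Ssup : ubound S (sup S) by apply: ub_le_sup; exists (rend g).
have supu : sup S <= rend g by apply: ge_sup => //; exists (lend g).
split=> //; have asup := Ssup _ S0; split; first by apply/domg; rewrite asup.
(* Left continuity is available only beyond [lend g]; at [lend g] the bound is the hypothesis. *)
move: asup; rewrite le_eqVlt => /predU1P[<-//|asup].
have /lc : lend g < sup S <= rend g by rewrite asup.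
move=> /cvgr_to_le; apply; near=> t.
have [e [/domg/andP[_ eu] ge] te] : exists2 e, S e & t < e.
  by apply: sup_gt; [exists (lend g)|near: t; exact: nbhs_left_lt].
apply: le_trans ge; apply: pwl_nd_le => //; last exact: ltW.
by near: t; exact: nbhs_left_ge.
Unshelve. all: by end_near. Qed.

(** (H) and monotonicity keep the values of [g] above [lend f], so only the bound [rend f] cuts the
    domain. *)
Lemma dom_pcomp_itv (R : realType) (f g : R -> option R) (v : R) :
  pwl_nd f -> pwl_nd g -> hypH f g ->
  is_max [set t | dom g t /\ pval g t <= rend f] v ->
  dom (pcomp f g) = `[lend g, v]%classic.
Proof.
move=> [/pwl_ends[_ domf _ _] _] ndg H [[/[dup] gv + gvu] vmax].
have [_ domg _ _] := pwl_ends ndg.1 => /domg/andP[av vu].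
rewrite dom_pcomp; apply/seteqP; split=> t /=; rewrite in_itv /=.
  move=> [gt /domf/andP[_ ft]].
  by rewrite (vmax t) // andbT; have /domg/andP[] := gt.
move=> /andP[at_ tv]; split; first by apply/domg; rewrite at_ (le_trans tv).
apply/domf; rewrite (le_trans H) ?(le_trans _ gvu) //; apply: pwl_nd_le => //.
exact: le_trans vu.
Qed.

Lemma pwl_nd_pcomp (R : realType) (f g : R -> option R) (v : R) :
  pwl_nd f -> pwl_nd g -> hypH f g ->
  is_max [set t | dom g t /\ pval g t <= rend f] v ->
  pwl_nd (pcomp f g).
Proof.
move=> ndf ndg H maxv; have domfg := dom_pcomp_itv ndf ndg H maxv.
have [_ domf lcf paf] := pwl_ends ndf.1.
have [_ domg lcg pag] := pwl_ends ndg.1.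
have [[/domg/andP[av vu] gvu] _] := maxv.
have fgE t : lend g <= t <= v -> pval (pcomp f g) t = pval f (pval g t).
  by move=> tv; apply: pval_pcomp; rewrite domfg /= in_itv.
have gle s t : lend g <= s -> s <= t -> t <= v -> pval g s <= pval g t.
  by move=> as_ st tv; apply: pwl_nd_le => //; exact: le_trans vu.
have gin t : lend g <= t -> t <= v -> lend f <= pval g t <= rend f.
  move=> at_ tv; apply/andP; split; first exact: (le_trans H (gle _ _ _ _ _)).
  exact: le_trans (gle _ _ _ _ _) gvu.
split; last first.
  move=> s t; rewrite !inE domfg /= !in_itv /= => sv tv st.
  rewrite !fgE //; move: sv tv => /andP[as_ sv] /andP[at_ tv].
  have /andP[fs _] := gin _ as_ sv; have /andP[_ ft] := gin _ at_ tv.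
  by apply: pwl_nd_le => //; exact: gle.
exists (lend g), v; split=> //.
- move=> t; rewrite in_itv /= => /andP[at_ tv].
  have lgt : pval g s @[s --> t^'-] --> pval g t.
    by apply: lcg; rewrite at_ (le_trans tv).
  rewrite /left_continuous_at fgE ?(ltW at_) //.
  have fgnear : {near t^'-, pval f \o pval g =1 pval (pcomp f g)}.
    near=> s; rewrite fgE //; apply/andP; split.
      by near: s; exact: nbhs_left_ge.
    by apply: le_trans tv; apply: ltW; near: s; exact: nbhs_left_lt.
  apply: cvg_trans (near_eq_cvg fgnear) _.
  have [[s0 [as0 s0t gs0]]|noconst] :=
      pselect (exists s0, [/\ lend g <= s0, s0 < t & pval g s0 = pval g t]).
    apply: (@cvg_trans _ (cst (pval f (pval g t)) s @[s --> t^'-])).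
      apply: near_eq_cvg; near=> s; rewrite /= /cst; congr pval.
      have s0s : s0 <= s by near: s; exact: nbhs_left_ge.
      have st : s <= t by apply: ltW; near: s; exact: nbhs_left_lt.
      by apply/le_anti/andP; split; [rewrite -gs0|]; apply: gle => //; lra.
    exact: cvg_cst.
  have glt s : lend g <= s -> s < t -> pval g s < pval g t.
    move=> as_ st; rewrite lt_neqAle (gle _ _ as_ (ltW st) tv) andbT.
    by apply/eqP => gst; apply: noconst; exists s.
  apply: (@cvg_comp _ _ _ (pval g) (pval f) _ (pval g t)^'-); last first.
    apply: lcf; have /andP[_ ->] := gin _ (ltW at_) tv.
    by rewrite andbT (le_lt_trans H) // glt.
  move=> A ltA.
  (* A left neighbourhood of [pval g t] is a full one restricted to smaller values; [glt] supplies
     the restriction. *)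
  have gA : \forall s \near t^'-, pval g s < pval g t -> A (pval g s).
    exact: lgt ltA.
  change (\forall s \near t^'-, A (pval g s)).
  near=> s; have : pval g s < pval g t -> A (pval g s) by near: s.
  apply; apply: glt; last by near: s; exact: nbhs_left_lt.
  by near: s; exact: nbhs_left_ge.
- have [Pf fP] := piecewise_affine_off paf.
  have [Pg gP] := piecewise_affine_off pag.
  (* When [lev q] is empty its [sup] is the default 0, a harmless extra cut point. *)
  pose lev q := [set t | lend g <= t <= v /\ pval g t <= q].
  apply: (@affine_off_piecewise _ (Pg ++ [seq sup (lev q) | q <- Pf])) => //.
  move=> x y ax xy yv offxy.
  have [|p pPg|m [c gmc]] := gP x y ax xy.
    exact: le_trans vu.
  by apply: offxy; rewrite mem_cat pPg.
  have gE t : x < t < y -> pval g t = m * t + c.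
    by move=> ?; apply: gmc; rewrite /= in_itv.
  have itvP t : x < t < y -> lend g <= t <= v by move=> ?; lra.
  have fgE' t : x < t < y -> pval (pcomp f g) t = pval f (m * t + c).
    by move=> txy; rewrite fgE ?gE ?itvP.
  have m_ge0 : 0 <= m.
    have h1 : x < (2 * x + y) / 3 < y by lra.
    have h2 : x < (x + 2 * y) / 3 < y by lra.
    have := gle ((2 * x + y) / 3) ((x + 2 * y) / 3).
    rewrite !gE // => /(_ _ _ _)/wrap[]; [lra..|].
    rewrite lerD2r -subr_ge0 -mulrBr => h3.
    have : 0 < (x + 2 * y) / 3 - (2 * x + y) / 3 by lra.
    by move=> /pmulr_lge0 <-.
  move: m_ge0; rewrite le_eqVlt => /predU1P[m0|m0].
    exists 0, (pval f c) => t /=; rewrite in_itv /= => txy.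
    by rewrite fgE' // -m0 !mul0r !add0r.
  (* Either [g] exceeds [q] on the whole piece, or [lev q] contains some [t0 > x]; its supremum is
     then not at most [x], hence at least [y], and [g <= q] throughout. *)
  have side q : q \in Pf -> q <= m * x + c \/ m * y + c <= q.
    move=> qPf; have [[t0 [t0xy gt0]]|no] :=
        pselect (exists t, x < t < y /\ m * t + c <= q); last first.
      left; apply: (affine_open_ge m0 xy) => // t txy.
      by rewrite leNgt; apply/negP => /ltW ?; apply: no; exists t.
    right; apply: (affine_open_le m0 xy) => // t txy.
    have levt0 : lev q t0 by split; [exact: itvP | rewrite gE].
    have t0sup : t0 <= sup (lev q).
      by apply: ub_le_sup => //; exists v => s [/andP[]].
    have [|supx|ysup] := offxy (sup (lev q)).
    + by rewrite mem_cat; apply/orP; right; apply: map_f.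
    + by lra.
    have tsup : t < sup (lev q) by lra.
    have [|e [/andP[ae ev] geq] te] := sup_gt _ tsup; first by exists t0.
    by rewrite -gE //; apply: le_trans geq; apply: gle; lra.
  have fin t : x < t < y -> lend f <= m * t + c <= rend f.
    by move=> txy; rewrite -gE //; have /andP[? ?] := itvP _ txy; exact: gin.
  have fx : lend f <= m * x + c.
    by apply: (affine_open_ge m0 xy) => t /fin/andP[].
  have fy : m * y + c <= rend f.
    by apply: (affine_open_le m0 xy) => t /fin/andP[].
  have mxy : m * x + c < m * y + c by rewrite ltrD2r ltr_pM2l.
  have [m' [c' fm]] := fP _ _ fx mxy fy side.
  exists (m' * m), (m' * c + c') => t /=; rewrite in_itv /= => txy.
  rewrite fgE' // fm; first by rewrite mulrDr mulrA addrA.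
  by rewrite /= in_itv /= !ltrD2r !ltr_pM2l.
Unshelve. all: by end_near. Qed.

Theorem theorem3p1 (R : realType) (f g : R -> option R)
    (hf : pwl_nd_bot f) (hg : pwl_nd_bot g) (f0 : f <> bot) (g0 : g <> bot)
    (H : hypH f g) :
  (pcomp f g = bot <-> pval g (lend g) > rend f) /\
  (pcomp f g <> bot ->
    [/\ dom (pcomp f g) = `[lend g, rend (pcomp f g)]%classic,
        is_max [set t | dom g t /\ pval g t <= rend f] (rend (pcomp f g)),
        pwl_nd (pcomp f g),
        lend (pcomp f g) = lend g
      & forall g' : R -> option R, pwl_nd_bot g' -> g' <> bot ->
          (hypH (pcomp f g) g' <-> hypH g g') /\
          (hypH g g' <-> lend g <= pval g' (lend g'))]).
Proof.
have ndf : pwl_nd f by case: hf.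
have ndg : pwl_nd g by case: hg.
have [auf domf _ _] := pwl_ends ndf.1.
have [aug domg _ _] := pwl_ends ndg.1.
have emptyP : pcomp f g = bot <-> pval g (lend g) > rend f.
  (* If [g (lend g) <= rend f], then (H) puts [lend g] itself in the domain; otherwise monotonicity
     keeps all values of [g] above [rend f]. *)
  rewrite neq_bot_dom dom_pcomp; split=> [dom0|gt].
    rewrite ltNge; apply/negP => gu.
    suff : set0 (lend g) by [].
    rewrite -dom0; split; first by apply/domg; rewrite lexx aug.
    by apply/domf; rewrite gu andbT.
  apply/seteqP; split=> // t [/domg/andP[at_ tu] /domf/andP[_]].
  by rewrite leNgt (lt_le_trans gt) // pwl_nd_le.
split=> // fg0; have gu : pval g (lend g) <= rend f.
  by rewrite leNgt; apply/negP => /emptyP.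
have [v maxv] := sublevel_has_max ndg gu.
have domfg := dom_pcomp_itv ndf ndg H maxv.
have av : lend g <= v by have [[/domg/andP[]]] := maxv.
have lendfg : lend (pcomp f g) = lend g.
  by rewrite {1}/lend domfg inf_itv ?bnd_simp.
have rendfg : rend (pcomp f g) = v by rewrite /rend domfg sup_itv ?bnd_simp.
rewrite rendfg; split=> //; first exact: pwl_nd_pcomp maxv.
by move=> g' _ _; rewrite /hypH lendfg.
Qed.
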